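(* Let $d\ge1$ and let $\alpha=(\alpha_1,\dots,\alpha_d)\in\mathbb{R}^d$ be an irrational vector. For any positive number $\gamma$ of the form $\gamma = n_0 + n_1\alpha_1+\cdots+n_d\alpha_d$ with $n_j\in\mathbb{Z}$, there is a parallelepiped $P$ in $\mathbb{R}^d$, spanned by vectors $v_1,\dots,v_d$ belonging to $\mathbb{Z}\alpha+\mathbb{Z}^d$, such that $\operatorname{mes} P = \gamma$. If $\gamma \leq 1$, then $P$ may be chosen to be a simple set.
   Context: A vector $\alpha = (\alpha_1,\dots,\alpha_d) \in \mathbb{R}^d$ is called irrational if $1, \alpha_1, \ldots, \alpha_d$ are linearly independent over $\mathbb{Q}$. We write $\mathbb{Z}\alpha+\mathbb{Z}^d = \{ n\alpha + m : n \in \mathbb{Z}, m \in \mathbb{Z}^d\}$, and $\operatorname{mes}$ for Lebesgue measure. A parallelepiped spanned by vectors $v_1,\dots,v_d$ is a set of the form $\{ \sum_{k=1}^d t_k v_k : 0 \leq t_k < 1 \}$, where $v_1,\dots,v_d$ are linearly independent vectors in $\mathbb{R}^d$. A bounded set $S\subset\mathbb{R}^d$ is simple if the function $\chi_S(x) = \sum_{k \in \mathbb{Z}^d} \mathbf{1}_S(x+k)$ takes only the values $0$ and $1$ (equivalently, the canonical projection $\mathbb{R}^d\to\mathbb{R}^d/\mathbb{Z}^d$ is injective on $S$). *)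

(* Defs.v *)
From HB Require Import structures.
From mathcomp Require Import all_boot all_order all_algebra.
From mathcomp Require Import all_classical all_reals all_analysis measurable_realfun.
Import Order.TTheory GRing.Theory Num.Theory.
Import numFieldNormedType.Exports.

Set Implicit Arguments.
Unset Strict Implicit.
Unset Printing Implicit Defensive.

Local Open Scope classical_set_scope.
Local Open Scope ring_scope.

(* The library has the product of two measures but no Lebesgue measure on R^n;
   it is built here as the n-fold product of [lebesgue_measure] on the product
   (Borel) sigma-algebra of n-tuples. *)
Section product_tuple.
Context {disp : measure_display} {T : measurableType disp} {R : realType}.
Variable m : {sigma_finite_measure set T -> \bar R}.

Definition tuple_cons n (p : T * n.-tuple T) : n.+1.-tuple T :=
  [tuple of p.1 :: p.2].

Definition tuple_uncons n (t : n.+1.-tuple T) : T * n.-tuple T :=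
  (thead t, [tuple of behead t]).

Lemma tuple_consK n : cancel (@tuple_cons n) (@tuple_uncons n).
Proof.
case=> x t; rewrite /tuple_uncons /tuple_cons /=; congr pair.
exact: val_inj.
Qed.

Lemma tuple_unconsK n : cancel (@tuple_uncons n) (@tuple_cons n).
Proof. by move=> t; rewrite [RHS]tuple_eta; exact: val_inj. Qed.

Lemma tnth_tuple_cons0 n x (t : n.-tuple T) : tnth (tuple_cons (x, t)) ord0 = x.
Proof. by []. Qed.

Lemma tnth_tuple_consS n x (t : n.-tuple T) i :
  tnth (tuple_cons (x, t)) (lift ord0 i) = tnth t i.
Proof. by rewrite !(tnth_nth x). Qed.

Lemma measurable_tuple_cons n : measurable_fun setT (@tuple_cons n).
Proof. by apply: measurable_cons. Qed.

Lemma measurable_tuple_uncons n : measurable_fun setT (@tuple_uncons n).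
Proof.
apply/measurable_fun_pair; first exact: measurable_tnth.
exact: measurable_behead.
Qed.

Section step.
Variables (n : nat) (mu : {sigma_finite_measure set (n.-tuple T) -> \bar R}).

Definition product_cons : set (n.+1.-tuple T) -> \bar R :=
  pushforward (m \x mu)%E (@tuple_cons n).

Let product_cons0 : product_cons set0 = 0%E.
Proof. by rewrite /product_cons /pushforward preimage_set0 measure0. Qed.

Let product_cons_ge0 A : (0 <= product_cons A)%E.
Proof. by rewrite /product_cons /pushforward measure_ge0. Qed.

Let product_cons_sigma_additive : semi_sigma_additive product_cons.
Proof.
move=> F mF tF mUF; rewrite /product_cons /pushforward preimage_bigcup.
apply: measure_semi_sigma_additive.
- by move=> i; rewrite -[X in measurable X]setTI; exact: measurable_tuple_cons.
- apply/trivIsetP => /= i j _ _ ij; rewrite -preimage_setI.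
  by move/trivIsetP : tF => /(_ i j Logic.I Logic.I ij) ->; rewrite preimage_set0.
- rewrite -preimage_bigcup -[X in measurable X]setTI.
  exact: measurable_tuple_cons.
Qed.

HB.instance Definition _ := isMeasure.Build _ _ _ product_cons
  product_cons0 product_cons_ge0 product_cons_sigma_additive.

Let product_cons_sigma_finite : sigma_finite setT product_cons.
Proof.
have /sigma_finiteP[F [TF ndF Foo]] := sigma_finiteT m.
have /sigma_finiteP[G [TG ndG Goo]] := sigma_finiteT mu.
exists (fun k => @tuple_uncons n @^-1` (F k `*` G k)).
  apply/seteqP; split => // t _.
  have [i _ Fi] : (\bigcup_k F k) (tuple_uncons t).1 by rewrite -TF.
  have [j _ Gj] : (\bigcup_k G k) (tuple_uncons t).2 by rewrite -TG.
  exists (maxn i j) => //; split.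
  - by move: Fi; exact/subsetPset/ndF/leq_maxl.
  - by move: Gj; exact/subsetPset/ndG/leq_maxr.
move=> k; have [mF Fk] := Foo k; have [mG Gk] := Goo k; split.
  rewrite -[X in measurable X]setTI; apply: measurable_tuple_uncons => //.
  exact: measurableX.
rewrite /product_cons /pushforward -comp_preimage.
have -> : @tuple_uncons n \o @tuple_cons n = id.
  by apply/funext => x /=; rewrite tuple_consK.
by rewrite preimage_id product_measure1E// lte_mul_pinfty// ge0_fin_numE.
Qed.

HB.instance Definition _ := Measure_isSigmaFinite.Build _ _ _ product_cons
  product_cons_sigma_finite.

End step.

Fixpoint product_tuple n : {sigma_finite_measure set (n.-tuple T) -> \bar R} :=
  match n with
  | 0 => \d_([tuple] : 0.-tuple T)
  | n'.+1 => product_cons (product_tuple n')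
  end.

End product_tuple.

Section lebesgue_tuple.
Context {R : realType}.
Local Notation T := (measurableTypeR R).

Definition lebesgue_tuple n : {sigma_finite_measure set (n.-tuple T) -> \bar R} :=
  product_tuple (@lebesgue_measure R) n.

Lemma lebesgue_tuple_box n (a b : 'I_n -> R) : (forall i, a i <= b i) ->
  lebesgue_tuple n [set t | forall i, a i <= tnth t i < b i] =
  (\prod_(i < n) (b i - a i))%:E.
Proof.
elim: n a b => [|n IH] a b ab.
  rewrite big_ord0 /= /dirac indicE mem_set// => i.
  by case: i.
rewrite /lebesgue_tuple /= /product_cons /pushforward.
pose B := [set t : n.-tuple T | forall i, a (lift ord0 i) <= tnth t i < b (lift ord0 i)].
have mB : measurable B.
  rewrite (_ : B = \bigcap_(i in [set: 'I_n])
      (fun t => tnth t i) @^-1` `[a (lift ord0 i), b (lift ord0 i)[%classic).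
    apply: fin_bigcap_measurable => // i _; rewrite -[X in measurable X]setTI.
    by apply: measurable_tnth => //; exact: measurable_itv.
  by apply/seteqP; split=> t /= H i; have := H i; rewrite /= in_itv//=; exact.
rewrite (_ : _ @^-1` _ = `[a ord0, b ord0[%classic `*` B); last first.
  apply/seteqP; split => -[x t] /=.
    move=> H; split => [|i /=]; first by rewrite in_itv; exact: (H ord0).
    by have := H (lift ord0 i); rewrite tnth_tuple_consS.
  move=> [/=]; rewrite in_itv/= => xab tB i.
  have [j ->|->//] := unliftP ord0 i.
  by rewrite tnth_tuple_consS.
rewrite product_measure1E//.
rewrite [X in (_ * X)%E]IH//.
rewrite [X in (X * _)%E](_ : _ = (b ord0 - a ord0)%:E).
  by rewrite big_ord_recl EFinM.
rewrite [LHS]lebesgue_measure_itv/= lte_fin.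
have := ab ord0; rewrite le_eqVlt => /predU1P[->|->]; last by rewrite EFinB.
by rewrite ltxx subrr.
Qed.

End lebesgue_tuple.

Section definitions.
Context {R : realType} {d : nat}.

Definition mes (A : set 'rV[R]_d) : \bar R :=
  lebesgue_tuple d [set t | A (\row_i tnth t i)].

Definition irrational_vector (alpha : 'rV[R]_d) : Prop :=
  forall (q0 : rat) (q : 'I_d -> rat),
    ratr q0 + \sum_(i < d) ratr (q i) * alpha ord0 i = 0 ->
    q0 = 0 /\ forall i, q i = 0.

Definition int_vector (m : 'rV[int]_d) : 'rV[R]_d := map_mx intr m.

(* Z alpha + Z^d *)
Definition Zspan (alpha : 'rV[R]_d) : set 'rV[R]_d :=
  [set x | exists (n : int) (m : 'rV[int]_d),
    x = n%:~R *: alpha + int_vector m].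

(* Meaningful as a parallelepiped when [v] is free. *)
Definition parallelepiped (v : d.-tuple 'rV[R]_d) : set 'rV[R]_d :=
  [set x | exists2 t : 'I_d -> R, (forall k, 0 <= t k < 1) &
    x = \sum_(k < d) t k *: tnth v k].

Definition chi (S : set 'rV[R]_d) (x : 'rV[R]_d) : \bar R :=
  (\esum_(k in [set: 'rV[int]_d]) (\1_S (x + int_vector k))%:E)%E.

Definition simple_set (S : set 'rV[R]_d) : Prop :=
  bounded_set S /\ forall x, chi S x = 0%E \/ chi S x = 1%E.

(* [mes] is the Borel Lebesgue measure, so it is meaningful on parallelepipeds
   because they are Borel sets. *)
Lemma measurable_parallelepiped (v : d.-tuple 'rV[R]_d) : free v ->
  measurable [set t : d.-tuple (measurableTypeR R) |
               parallelepiped v (\row_i tnth t i)].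
Proof.
move=> vfree; pose V : 'M[R]_d := \matrix_k tnth v k.
have sumV (t : 'rV[R]_d) : t *m V = \sum_(k < d) t ord0 k *: tnth v k.
  by rewrite mulmx_sum_row; apply: eq_bigr => k _; rewrite rowK.
have Vu : V \in unitmx.
  rewrite -row_free_unit -kermx_eq0; apply/eqP/row_matrixP => i.
  have : row i (kermx V) *m V = 0 by rewrite -row_mul mulmx_ker row0.
  rewrite sumV row0 => s0; apply/rowP => k; rewrite [RHS]mxE.
  move/freeP : vfree => /(_ (fun k => row i (kermx V) ord0 k)); apply.
  by rewrite -[RHS]s0; apply: eq_bigr => j _; rewrite (tnth_nth 0).
pose f k (t : d.-tuple (measurableTypeR R)) : R :=
  \sum_(i < d) tnth t i * invmx V i k.
rewrite (_ : [set _ | _] = \bigcap_(k in [set: 'I_d]) f k @^-1` `[0, 1[%classic).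
  apply: fin_bigcap_measurable => // k _; rewrite -[X in measurable X]setTI.
  apply: (_ : measurable_fun _ (f k)) => //; apply: measurable_sum => i.
  by apply: measurable_funM => //; exact: measurable_tnth.
have fE t k : f k t = ((\row_i tnth t i) *m invmx V) ord0 k.
  by rewrite mxE; apply: eq_bigr => i _; rewrite mxE.
apply/seteqP; split => t /=.
  move=> [c c01 tE] k _; rewrite /= in_itv/= fE tE.
  have -> : \sum_(k < d) c k *: tnth v k = (\row_k c k) *m V.
    by rewrite sumV; apply: eq_bigr => j _; rewrite mxE.
  by rewrite mulmxK// mxE.
move=> H; exists (fun k => f k t).
  by move=> k; have := H k Logic.I; rewrite /= in_itv.
rewrite -[LHS](mulmxKV Vu) sumV; apply: eq_bigr => k _.
by rewrite fE.
Qed.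

End definitions.

(* Main.v *)
Require Import Defs.
From mathcomp Require Import all_boot all_order all_algebra.
From mathcomp Require Import all_classical all_reals all_analysis.
From mathcomp Require Import measurable_realfun ring lra.
Import Order.TTheory GRing.Theory Num.Theory.
Import numFieldNormedType.Exports.

Set Implicit Arguments.
Unset Strict Implicit.
Unset Printing Implicit Defensive.

Local Open Scope classical_set_scope.
Local Open Scope ring_scope.

(** Collect the integers [n_i] in a column. An integer column can be brought to
    the form [g e_0] by a unimodular integer matrix, so [n = L (g e_0)] for some
    [L] in GL_d(Z) ([int_col_reduce]). The automorphism [x |-> x L] of R^d
    preserves Z^d and volumes and turns [alpha] into [beta = alpha L]; in the new
    coordinates the hypothesis on [gamma] reads [gamma = n0 + g beta_0]. There
    the vector [w_0 = g beta + n0 e_0] has first coordinate [gamma], so together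
    with [e_1, ..., e_(d-1)] it spans a parallelepiped with triangular matrix
    and determinant [gamma]. Its image under [L^-1] is spanned by vectors of
    Z alpha + Z^d, and this is the required parallelepiped, for every
    [gamma > 0].

    When [gamma <= 1] this parallelepiped is simple. If two points with
    parameters [s] and [t] differ by an integer vector, the first coordinate
    says that [(s_0 - t_0) gamma] is an integer of absolute value less than 1,
    so [s_0 = t_0]; then the other [s_j - t_j] are integers of absolute value
    less than 1, so they vanish too ([simple_sheared_cube]).

    The volume is a determinant by the linear change of variables for [mes]
    ([scales_mes_unitmx]), which follows from Fubini's theorem by induction on
    the dimension. Writing an invertible matrix in blocks [[a, r], [c, D]] with
    [a <> 0], one has
    [[a, r], [c, D]] = [[a, 0], [c, 1]] * [[1, r / a], [0, D - c r / a]].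
    The first factor acts by an affine map of the line on each fibre of the
    last coordinates, and the second one acts on each fibre of the first
    coordinate by a translation composed with a matrix of smaller size. *)

(** * Affine maps of the line *)

(** Both sides are measures in [A], so it is enough to compare them on
    half-open intervals; an interval is reversed when [a < 0]. *)
Lemma lebesgue_measure_affine (R : realType) (a b : R) (A : set R) :
  a != 0 -> measurable A ->
  (`|a|%:E * lebesgue_measure [set x | A (x * a + b)%R] =
   lebesgue_measure A)%E.
Proof.
move=> a0 mA.
pose f (x : measurableTypeR R) : measurableTypeR R := x * a + b.
have mf : measurable_fun setT f.
  apply: measurable_funD => //; exact: measurable_funM.
pose r : {nonneg R} := NngNum (normr_ge0 a).
pose m : {measure set (measurableTypeR R) -> \bar R} :=
  mscale r (pushforward lebesgue_measure f).
apply/esym; rewrite (@lebesgue_measure_unique R (m mf))//= => _ [[u v]] _ <-.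
rewrite /m /mscale /= /pushforward.
have [a_gt0|a_le0] := ltP 0 a.
  rewrite (_ : _ @^-1` _ = `](u - b) / a, (v - b) / a]%classic); last first.
    apply/seteqP; split=> x /=; rewrite !in_itv/= /f ltr_pdivrMr// ler_pdivlMr//.
      by move=> /andP[? ?]; rewrite ltrBlDr lerBrDr; apply/andP.
    by rewrite ltrBlDr lerBrDr.
  rewrite !lebesgue_measure_itv/= !lte_fin ltr_pM2r ?invr_gt0// ltrD2r.
  case: ifP => _; last by rewrite mule0.
  rewrite -!EFinB -EFinM gtr0_norm//; by congr (_%:E); field.
have a_lt0 : a < 0 by rewrite lt_neqAle a0.
rewrite (_ : _ @^-1` _ = `[(v - b) / a, (u - b) / a[%classic); last first.
  apply/seteqP; split=> x /=; rewrite !in_itv/= /f ltr_ndivlMr// ler_ndivrMr//.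
    by move=> /andP[? ?]; rewrite ltrBlDr lerBrDr; apply/andP.
  by rewrite ltrBlDr lerBrDr andbC.
rewrite !lebesgue_measure_itv/= !lte_fin ltr_nM2r ?invr_lt0// ltrD2r.
case: ifP => _; last by rewrite mule0.
rewrite -!EFinB -EFinM ltr0_norm//; by congr (_%:E); field.
Qed.

(** * Fubini for the product measure on row vectors *)

Section slicing.
Context {R : realType}.
Local Notation T := (measurableTypeR R).

Definition row_of n (t : n.-tuple T) : 'rV[R]_n := \row_i tnth t i.

Definition borel_rV n (A : set 'rV[R]_n) : Prop :=
  measurable [set t : n.-tuple T | A (row_of t)].

Lemma borel_rV_affine n (M : 'M[R]_n) (b : 'rV[R]_n) (A : set 'rV[R]_n) :
  borel_rV A -> borel_rV [set x | A (x *m M + b)].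
Proof.
move=> mA.
pose f (t : n.-tuple T) : n.-tuple T := [tuple (row_of t *m M + b) ord0 i | i < n].
have fE t : row_of (f t) = row_of t *m M + b.
  by apply/rowP => i; rewrite mxE tnth_mktuple.
have mf : measurable_fun setT f.
  apply/measurable_fun_tnthP => i.
  rewrite (_ : _ \o _ = fun t : n.-tuple T =>
      \sum_(j < n) tnth t j * M j i + b ord0 i).
    apply: measurable_funD => //; apply: measurable_sum => j.
    by apply: measurable_funM => //; exact: measurable_tnth.
  apply/funext => t /=; rewrite tnth_mktuple !mxE; congr (_ + _).
  by apply: eq_bigr => j _; rewrite mxE.
rewrite /borel_rV (_ : [set t | _] = f @^-1` [set t | A (row_of t)]).
  by rewrite -[X in measurable X]setTI; exact: mf.
by apply/seteqP; split => t /=; rewrite fE.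
Qed.

Lemma row_of_cons n (x : R) (t : n.-tuple T) :
  row_of (tuple_cons (x, t)) = row_mx x%:M (row_of t) :> 'rV_(1 + n).
Proof.
apply/rowP => i; rewrite [LHS]mxE; case: (split_ordP i) => j ->.
  rewrite row_mxEl ord1 mxE eqxx mulr1n -[RHS](tnth_tuple_cons0 x t).
  by congr (tnth _ _); apply: val_inj.
rewrite row_mxEr mxE -[RHS](tnth_tuple_consS x).
by congr (tnth _ _); apply: val_inj.
Qed.

Definition pairs_of n (A : set 'rV[R]_(1 + n)) : set (T * n.-tuple T) :=
  [set p | A (row_mx p.1%:M (row_of p.2))].

Lemma measurable_pairs_of n (A : set 'rV[R]_(1 + n)) :
  borel_rV A -> measurable (pairs_of A).
Proof.
move=> mA.
rewrite (_ : pairs_of A = @tuple_cons _ _ n @^-1` [set t | A (row_of t)]).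
  by rewrite -[X in measurable X]setTI; apply: measurable_tuple_cons.
by apply/seteqP; split => -[x t]; rewrite /pairs_of/= row_of_cons.
Qed.

Lemma mes_pairs n (A : set 'rV[R]_(1 + n)) :
  mes A = (@lebesgue_measure R \x lebesgue_tuple n)%E (pairs_of A).
Proof.
rewrite /mes /lebesgue_tuple /= /product_cons /pushforward.
congr (_ _); apply/seteqP.
by split => -[x t]; rewrite /pairs_of/= -[\row_i _]/(row_of _) row_of_cons.
Qed.

(** Fubini, with the first coordinate in the outer integral: proportional
    measures on all fibres give proportional measures. *)
Lemma mes_fibres_tail n (A B : set 'rV[R]_(1 + n)) (c : R) :
  0 <= c -> borel_rV A -> borel_rV B ->
  (forall x, c%:E * mes [set y : 'rV_n | A (row_mx x%:M y)] =
             mes [set y : 'rV_n | B (row_mx x%:M y)])%E ->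
  (c%:E * mes A = mes B)%E.
Proof.
move=> c0 /measurable_pairs_of mA /measurable_pairs_of mB AB.
rewrite !mes_pairs /product_measure1.
rewrite -ge0_integralZl//; last exact: measurable_fun_xsection.
apply: eq_integral => x _ /=.
have secE (C : set 'rV[R]_(1 + n)) : xsection (pairs_of C) x =
    [set t | [set y : 'rV_n | C (row_mx x%:M y)] (\row_i tnth t i)].
  by apply/seteqP; split => t; rewrite /xsection /= inE.
by have := AB x; rewrite /mes -!secE.
Qed.

(** The same comparison with the first coordinate in the inner integral.
    The two measurability premises are there because the comparison on the line
    will be [lebesgue_measure_affine], which needs measurable fibres. *)
Lemma mes_fibres_head n (A B : set 'rV[R]_(1 + n)) (c : R) :
  0 <= c -> borel_rV A -> borel_rV B ->
  (forall y : 'rV_n,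
     measurable [set x : T | A (row_mx x%:M y)] ->
     measurable [set x : T | B (row_mx x%:M y)] ->
     c%:E * @lebesgue_measure R [set x : R | A (row_mx x%:M y)] =
     @lebesgue_measure R [set x : R | B (row_mx x%:M y)])%E ->
  (c%:E * mes A = mes B)%E.
Proof.
move=> c0 /measurable_pairs_of mA /measurable_pairs_of mB AB.
have swap (C : set (T * n.-tuple T)) : measurable C ->
    (@lebesgue_measure R \x lebesgue_tuple n)%E C =
    (\int[lebesgue_tuple n]_t (@lebesgue_measure R \o ysection C) t)%E.
  move=> mC; rewrite -[RHS]/((@lebesgue_measure R \x^ lebesgue_tuple n)%E C).
  by apply: product_measure_unique => // D E mD mE; exact: product_measure2E.
rewrite !mes_pairs !swap//.
rewrite -ge0_integralZl//; last exact: measurable_fun_ysection.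
apply: eq_integral => t _ /=.
have secE (C : set 'rV[R]_(1 + n)) : ysection (pairs_of C) t =
    [set x : T | C (row_mx x%:M (row_of t))].
  by apply/seteqP; split => x; rewrite /ysection /= inE.
have := AB (row_of t); rewrite -!secE; apply; exact: measurable_ysection.
Qed.

End slicing.

(** * Linear change of variables *)

Section change_of_variables.
Context {R : realType}.

Lemma borel_rV_mulmx n (M : 'M[R]_n) (A : set 'rV[R]_n) :
  borel_rV A -> borel_rV [set x | A (x *m M)].
Proof.
move=> /(borel_rV_affine M 0); congr (borel_rV _).
by apply/seteqP; split=> x /=; rewrite addr0.
Qed.

Lemma borel_rV_translate n (b : 'rV[R]_n) (A : set 'rV[R]_n) :
  borel_rV A -> borel_rV [set x | A (x + b)].
Proof.
move=> /(borel_rV_affine 1%:M b); congr (borel_rV _).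
by apply/seteqP; split=> x /=; rewrite mulmx1.
Qed.

Lemma borel_rV_slice n (A : set 'rV[R]_(1 + n)) (x : R) :
  borel_rV A -> borel_rV [set y : 'rV_n | A (row_mx x%:M y)].
Proof.
move=> /measurable_pairs_of/(measurable_xsection x); congr measurable.
by apply/seteqP; split => t; rewrite /xsection /= inE.
Qed.

Lemma mes_translate n (b : 'rV[R]_n) (A : set 'rV[R]_n) :
  borel_rV A -> mes [set x | A (x + b)] = mes A.
Proof.
elim: n b A => [|n IH] b A mA.
  by congr mes; apply/seteqP; split=> x /=; rewrite (thinmx0 b) addr0.
rewrite -[n.+1]/(1 + n)%N in b A mA *.
have [b0 [b1 ->]] : exists (b0 : R) (b1 : 'rV_n), b = row_mx b0%:M b1.
  by exists (lsubmx b 0 0), (rsubmx b); rewrite -mx11_scalar hsubmxK.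
(* Translate the last coordinates and the first one in turn: [B] is the
   intermediate set. *)
pose B := [set x : 'rV[R]_(1 + n) | A (x + row_mx b0%:M 0)].
have mB : borel_rV B by exact: borel_rV_translate.
transitivity (mes B).
  rewrite -[LHS]mul1e; apply: mes_fibres_tail => //.
    exact: borel_rV_translate.
  move=> x; rewrite mul1e -[RHS](IH b1); last exact: borel_rV_slice.
  by congr mes; apply/seteqP; split=> y; rewrite /B /= !add_row_mx addr0.
rewrite -[LHS]mul1e; apply: mes_fibres_head => // y mBy mAy.
rewrite -[RHS](@lebesgue_measure_affine _ 1 b0) ?oner_eq0//.
rewrite normr1; congr (_ * lebesgue_measure _)%E.
by apply/seteqP; split=> x; rewrite /B /= add_row_mx addr0 mulr1 raddfD.
Qed.

Definition scales_mes n (M : 'M[R]_n) :=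
  forall A : set 'rV[R]_n, borel_rV A ->
    (`|\det M|%:E * mes [set x | A (x *m M)] = mes A)%E.

Lemma scales_mes_mul n (M N : 'M[R]_n) :
  scales_mes M -> scales_mes N -> scales_mes (M *m N).
Proof.
move=> hM hN A mA; rewrite det_mulmx normrM mulrC EFinM -muleA.
rewrite -[RHS](hN A mA) -[in RHS]hM; last exact: borel_rV_mulmx.
by congr (_ * (_ * mes _))%E; apply/seteqP; split=> x /=; rewrite mulmxA.
Qed.

(** On the fibre over the first coordinate [x], this matrix acts as [D] followed
    by the translation by [x r]. *)
Lemma scales_mes_tail n (r : 'rV[R]_n) (D : 'M[R]_n) :
  scales_mes D -> scales_mes (block_mx (1%:M : 'M[R]_1) r 0 D).
Proof.
move=> hD A mA; rewrite det_ublock det1 mul1r.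
apply: mes_fibres_tail => //; first exact: borel_rV_mulmx.
move=> x; pose B := [set y : 'rV_n | A (row_mx x%:M y)].
have mB : borel_rV B by exact: borel_rV_slice.
rewrite -[RHS](mes_translate (x *: r))// -[RHS]hD; last exact: borel_rV_translate.
congr (_ * mes _)%E; apply/seteqP.
by split=> y; rewrite /B /= mul_row_block mulmx1 mulmx0 addr0 mul_scalar_mx addrC.
Qed.

(** On the fibre over the last coordinates [y], this matrix acts on the line as
    [x |-> x a + y c]. *)
Lemma scales_mes_head n (a : R) (c : 'cV[R]_n) :
  a != 0 -> scales_mes (block_mx (a%:M : 'M[R]_1) 0 c 1%:M).
Proof.
move=> a0 A mA; rewrite det_lblock det1 mulr1 det_scalar1.
apply: mes_fibres_head => //; first exact: borel_rV_mulmx.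
move=> y _ mAy; rewrite -[RHS](@lebesgue_measure_affine _ a ((y *m c) 0 0))//.
congr (_ * lebesgue_measure _)%E; apply/funext => x /=.
rewrite mul_row_block !mulmx0 mulmx1 add0r -scalar_mxM.
by rewrite [y *m c in LHS]mx11_scalar -raddfD.
Qed.

(** Induction on the size through the Schur complement of the corner entry. If
    that entry vanishes, a shear adds to the first row another row whose leading
    entry does not vanish. *)
Lemma scales_mes_unitmx n (M : 'M[R]_n) : M \in unitmx -> scales_mes M.
Proof.
elim: n M => [|n IH] M uM.
  move=> A mA; rewrite det_mx00 normr1 mul1e; congr mes.
  by apply/seteqP; split=> x /=; rewrite [M]flatmx0 [x]thinmx0 mul0mx.
rewrite -[n.+1]/(1 + n)%N in M uM *.
(* a shear with inverse [U (-1)] makes the corner entry nonzero *)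
wlog M00 : M uM / M 0 0 != 0 => [hwlog|].
  have [M00|] := eqVneq (M 0 0) 0; last exact: hwlog.
  have [i Mi0] : exists i, M i 0 != 0.
    apply/existsP; apply: contraLR uM => /existsPn M0.
    rewrite unitmxE unitfE negbK (expand_det_col _ 0) big1// => i _.
    by move/negPn: (M0 i) => /eqP ->; rewrite mul0r.
  have [j iE] : exists j, i = rshift 1 j.
    case: (split_ordP i) => j iE; last by exists j.
    move: Mi0; rewrite iE (ord1 j) (_ : lshift n 0 = 0 :> 'I_(1 + n)).
      by rewrite M00 eqxx.
    exact: val_inj.
  pose U (s : R) : 'M[R]_(1 + n) := block_mx 1%:M (s *: delta_mx 0 j) 0 1%:M.
  have UU : U (-1) *m U 1 = 1%:M.
    rewrite /U mulmx_block !mul1mx !mulmx0 !mulmx1 !mul0mx !addr0 !add0r.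
    by rewrite scale1r scaleN1r subrr -scalar_mx_block.
  have hU s : scales_mes (U s).
    apply: scales_mes_tail => A mA; rewrite det1 normr1 mul1e.
    by congr mes; apply/seteqP; split=> x /=; rewrite mulmx1.
  rewrite -[M]mul1mx -UU -mulmxA; apply: scales_mes_mul => //.
  apply: hwlog; first by rewrite unitmx_mul uM andbT; case/mulmx1_unit: UU.
  have z : (0 : 'I_(1 + n)) = lshift n 0 by apply: val_inj.
  have U0l : U 1 0 (lshift n 0) = 1 by rewrite {1}z block_mxEul mxE.
  have U0r k : U 1 0 (rshift 1 k) = (k == j)%:R.
    by rewrite z block_mxEur 2!mxE mul1r.
  rewrite mxE big_split_ord big_ord1 /= U0l -z M00 mulr0 add0r.
  rewrite (bigD1 j)//= U0r eqxx mul1r -iE big1 ?addr0// => k kj.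
  by rewrite U0r (negbTE kj) mul0r.
set a := M 0 0 in M00.
pose D := drsubmx M - a^-1 *: (dlsubmx M *m ursubmx M).
have ME : M = block_mx (a%:M : 'M[R]_1) 0 (dlsubmx M) 1%:M *m
              block_mx 1%:M (a^-1 *: ursubmx M) 0 D.
  rewrite mulmx_block !mulmx1 !mulmx0 !mul0mx !mul1mx !addr0 mul_scalar_mx.
  rewrite scalerA divff// scale1r -scalemxAr /D addrC subrK.
  rewrite -[LHS]submxK; congr (block_mx _ _ _ _).
  rewrite [LHS]mx11_scalar !mxE /a.
  by congr (M _ _)%:M; apply: val_inj.
rewrite ME; apply: scales_mes_mul; first exact: scales_mes_head.
apply/scales_mes_tail/IH; move: uM.
by rewrite ME unitmx_mul => /andP[_]; rewrite !unitmxE det_ublock det1 mul1r.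
Qed.

End change_of_variables.

(** * Volume and simplicity of parallelepipeds *)

Section parallelepipeds.
Context {R : realType} {d : nat}.
Implicit Type v : d.-tuple 'rV[R]_d.

Definition spanning_mx v : 'M[R]_d := \matrix_k tnth v k.

Lemma mul_spanning_mx v (t : 'rV[R]_d) :
  t *m spanning_mx v = \sum_(k < d) t ord0 k *: tnth v k.
Proof. by rewrite mulmx_sum_row; apply: eq_bigr => k _; rewrite rowK. Qed.

Lemma parallelepipedP v (x : 'rV[R]_d) :
  parallelepiped v x <->
  exists2 t : 'rV[R]_d, (forall k, 0 <= t ord0 k < 1) & x = t *m spanning_mx v.
Proof.
split=> [[t t01 ->]|[t t01 ->]].
  exists (\row_k t k) => [k|]; first by rewrite mxE.
  by rewrite mul_spanning_mx; apply: eq_bigr => k _; rewrite mxE.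
by exists (t ord0) => //; rewrite mul_spanning_mx.
Qed.

Lemma spanning_mx_free v : spanning_mx v \in unitmx -> free v.
Proof.
move=> vu; apply/freeP => c c0 k.
have /(congr1 (mulmx^~ (invmx (spanning_mx v)))) :
    (\row_k c k) *m spanning_mx v = 0.
  rewrite mul_spanning_mx -[RHS]c0; apply: eq_bigr => j _.
  by rewrite mxE (tnth_nth 0).
by rewrite mulmxK// mul0mx => /rowP/(_ k); rewrite !mxE.
Qed.

(** [x |-> x V] maps the half-open unit cube onto the parallelepiped, where [V]
    has the spanning vectors as rows. *)
Lemma mes_parallelepiped v : spanning_mx v \in unitmx ->
  mes (parallelepiped v) = `|\det (spanning_mx v)|%:E.
Proof.
move=> vu; rewrite -(scales_mes_unitmx vu); last first.
  exact: (measurable_parallelepiped (spanning_mx_free vu)).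
have -> : [set x | parallelepiped v (x *m spanning_mx v)] =
          [set x | forall k, 0 <= x ord0 k < 1].
  apply/seteqP; split=> x /=; rewrite parallelepipedP; last by exists x.
  move=> [t t01 /(congr1 (mulmx^~ (invmx (spanning_mx v))))].
  by rewrite !mulmxK// => ->.
have := @lebesgue_tuple_box R d (fun=> 0) (fun=> 1) (fun=> ler01).
rewrite big1 => [box1|i _]; last by rewrite subr0.
rewrite -[RHS]mule1 -box1; congr (_ * lebesgue_tuple d _)%E.
by apply/seteqP; split=> t /= H i; have := H i; rewrite mxE.
Qed.

Lemma bounded_parallelepiped v : bounded_set (parallelepiped v).
Proof.
exists (\sum_(k < d) `|tnth v k|); split; first exact: num_real.
move=> M vM x [t t01 ->]; apply: le_trans (ltW vM).
apply: le_trans (ler_norm_sum _ _ _) _; apply: ler_sum => k _.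
rewrite normrZ ler_piMl//; have /andP[t0 t1] := t01 k.
by rewrite ger0_norm// ltW.
Qed.

(** [chi S x] counts the integer translates of [x] that lie in [S]; the hypothesis
    leaves at most one of them. *)
Lemma simple_set_of_injective (S : set 'rV[R]_d) : bounded_set S ->
  (forall (x : 'rV[R]_d) (k : 'rV[int]_d), S x -> S (x + int_vector k) -> k = 0) ->
  simple_set S.
Proof.
move=> bS inj; split=> // x; rewrite /chi.
have [[k Sk]|noS] := pselect (exists k, S (x + int_vector k)); [right|left]; last first.
  by apply: esum1 => k _; rewrite indicE memNset// => Sk; apply: noS; exists k.
rewrite [LHS](_ : _ = (\esum_(j in [set k]) (\1_S (x + int_vector j))%:E)%E).
  by rewrite esum_set1 ?lee_fin ?indicE// mem_set.
rewrite [LHS]esum_mkcond [RHS]esum_mkcond; apply: eq_esum => j _.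
rewrite [in LHS]mem_set//; case: ifPn => // /negP jk.
rewrite indicE memNset// => Sj; apply: jk; rewrite inE /=.
have jkE : x + int_vector j = x + int_vector k + int_vector (j - k).
  rewrite -addrA; congr (_ + _).
  by apply/rowP => i; rewrite !mxE intrB addrC subrK.
by apply/subr0_eq; apply: (inj _ _ Sk); rewrite -jkE.
Qed.

End parallelepipeds.

(** * Integer matrices *)

(** The right-hand factor of the Smith form of a column is a [1 x 1] matrix, so
    it can be absorbed into [g]. *)
Lemma int_col_reduce k (u : 'cV[int]_(1 + k)) :
  exists2 L : 'M[int]_(1 + k), L \in unitmx &
    exists g : int, u = L *m col_mx (g%:M : 'M[int]_1) 0.
Proof.
have [L uL [Q _ [s _ ->]]] := int_Smith_normal_form u.
exists L => //; exists (s`_0 * Q 0 0); rewrite -mulmxA; congr (L *m _).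
apply/matrixP => i j; rewrite !ord1 mxE big_ord1 mxE.
case: (split_ordP i) => l ->; first by rewrite col_mxEu mxE !ord1.
by rewrite col_mxEd mxE mulr0n mul0r.
Qed.

Lemma norm_det_int_unitmx (R : realType) k (L : 'M[int]_k) : L \in unitmx ->
  `|\det (map_mx intr L : 'M[R]_k)| = 1.
Proof.
rewrite unitmxE det_map_mx => /orP[] /eqP ->; first by rewrite normr1.
by rewrite rmorphN1 normrN1.
Qed.

Lemma eq0_intr_norm_lt1 (R : realType) (m : int) : `|m%:~R : R| < 1 -> m = 0.
Proof.
rewrite -intr_norm -[X in _ < X]/(1%:~R) ltr_int => m1.
by apply/eqP; rewrite -normr_le0 -ltzD1 add0r.
Qed.

Lemma unit_coords_dist (R : realType) (s t : R) :
  0 <= s < 1 -> 0 <= t < 1 -> `|t - s| < 1.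
Proof. by move=> *; rewrite ltr_norml; lra. Qed.

(** * The construction *)

Section construction.
Context {R : realType} {k : nat}.
Variables (alpha : 'rV[R]_(1 + k)) (gamma : R) (n0 g : int) (L : 'M[int]_(1 + k)).
Hypothesis (uL : L \in unitmx).

Let LR : 'M[R]_(1 + k) := map_mx intr L.
Let KR : 'M[R]_(1 + k) := map_mx intr (invmx L).
Let beta := alpha *m LR.

Hypothesis gammaE : gamma = n0%:~R + beta 0 0 * g%:~R.
Hypothesis gamma_gt0 : 0 < gamma.

(* In the coordinates [x L] the rows of [W] are [g beta + n0 e_0], whose first
   entry is [gamma], and [e_1, ..., e_k]. *)
Let W : 'M[R]_(1 + k) :=
  block_mx (gamma%:M : 'M[R]_1) (g%:~R *: rsubmx beta) 0 1%:M.

Definition sheared_cube : (1 + k).-tuple 'rV[R]_(1 + k) :=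
  [tuple row i (W *m KR) | i < 1 + k].

Let LK : LR *m KR = 1%:M.
Proof. by rewrite -map_mxM mulmxV// map_mx1. Qed.

Let KL : KR *m LR = 1%:M.
Proof. by rewrite -map_mxM mulVmx// map_mx1. Qed.

Lemma spanning_sheared_cube : spanning_mx sheared_cube = W *m KR.
Proof. by apply/row_matrixP => i; rewrite rowK tnth_mktuple. Qed.

Lemma norm_det_sheared_cube : `|\det (spanning_mx sheared_cube)| = gamma.
Proof.
rewrite spanning_sheared_cube det_mulmx normrM norm_det_int_unitmx ?unitmx_inv//.
by rewrite mulr1 det_ublock det1 mulr1 det_scalar1 gtr0_norm.
Qed.

Lemma spanning_sheared_cube_unit : spanning_mx sheared_cube \in unitmx.
Proof.
by rewrite unitmxE unitfE -normr_gt0 norm_det_sheared_cube.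
Qed.

(** The first spanning vector is [(g beta + n0 e_0) L^-1], which is [g alpha] plus
    [n0] times a row of [L^-1]; the others are rows of [L^-1], which is an
    integer matrix. *)
Lemma sheared_cube_Zspan i : Zspan alpha (tnth sheared_cube i).
Proof.
rewrite tnth_mktuple row_mul; case: (split_ordP i) => j ->.
  exists g, (n0 *: row 0 (invmx L)).
  have -> : row (lshift k j) W = g%:~R *: beta + n0%:~R *: delta_mx 0 0.
    rewrite /W block_mxEv rowKu row_id.
    have z : (0 : 'I_(1 + k)) = lshift k 0 by apply: val_inj.
    apply/rowP => l; case: (split_ordP l) => l' ->.
      rewrite row_mxEl ord1 -z !mxE eqxx mulr1 gammaE addrC mulrC.
      by rewrite /beta !mxE.
    by rewrite row_mxEr !mxE mulr0 addr0.
  rewrite mulmxDl -!scalemxAl /beta -mulmxA LK mulmx1 -rowE; congr (_ + _).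
  by apply/rowP => l; rewrite !mxE rmorphM.
exists 0, (row (rshift 1 j) (invmx L)).
rewrite scale0r add0r /int_vector map_row -/KR.
have -> : row (rshift 1 j) W = delta_mx 0 (rshift 1 j).
  rewrite /W block_mxEv rowKd; apply/rowP => l; rewrite mxE.
  case: (split_ordP l) => l' ->; first by rewrite row_mxEl !mxE eq_lrshift andbF.
  by rewrite row_mxEr !mxE eqxx eq_rshift eq_sym.
by rewrite -rowE.
Qed.

(** Multiplication by [L] permutes Z^d, so simplicity can be tested on the
    triangular matrix [W], one coordinate after the other. *)
Lemma simple_sheared_cube : gamma <= 1 -> simple_set (parallelepiped sheared_cube).
Proof.
move=> gamma1; apply: simple_set_of_injective; first exact: bounded_parallelepiped.
move=> x m /parallelepipedP[t t01 ->] /parallelepipedP[s s01].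
rewrite spanning_sheared_cube => sE.
pose e := s - t.
have e1 i : `|e 0 i| < 1 by rewrite !mxE; apply: unit_coords_dist.
have eW : e *m W = int_vector (m *m L).
  rewrite /int_vector map_mxM -/LR -[LHS]mulmx1 -KL !mulmxA; congr (_ *m _).
  by rewrite -mulmxA mulmxBl -sE addrC addKr.
have eE : e = row_mx (lsubmx e 0 0)%:M (rsubmx e).
  by rewrite -mx11_scalar hsubmxK.
have := eW; rewrite [in LHS]eE mul_row_block !mulmx0 addr0 mulmx1 -scalar_mxM => eW'.
(* The first coordinate of an integer translation is [e_0 gamma], with
   [|e_0| < 1] and [gamma <= 1]. *)
have e00 : lsubmx e 0 0 = 0.
  have /(congr1 (fun w : 'rV_(1 + k) => w 0 (lshift k 0))) := eW'.
  rewrite row_mxEl mxE eqxx mulr1n [RHS]mxE => eg.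
  have /eq0_intr_norm_lt1 m0 : `|((m *m L) 0 (lshift k 0))%:~R : R| < 1.
    rewrite -eg normrM (gtr0_norm gamma_gt0) mxE.
    by apply: le_lt_trans (e1 (lshift k 0)); rewrite ler_piMr.
  by move/eqP : eg; rewrite m0 mulf_eq0 (gt_eqF gamma_gt0) orbF => /eqP.
have eS j : e 0 (rshift 1 j) = 0.
  have /(congr1 (fun w : 'rV_(1 + k) => w 0 (rshift 1 j))) := eW'.
  rewrite row_mxEr e00 [_%:M]raddf0 mul0mx add0r [RHS]mxE [LHS]mxE => ej.
  by have := e1 (rshift 1 j); rewrite ej => /eq0_intr_norm_lt1 ->.
have e0 : e = 0.
  rewrite eE e00; apply/rowP => l; rewrite [RHS]mxE; case: (split_ordP l) => j ->.
    by rewrite row_mxEl mxE mul0rn.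
  by rewrite row_mxEr mxE eS.
have mL0 : m *m L = 0.
  apply/rowP => l; rewrite [RHS]mxE; apply: (@intr_inj R).
  by move: eW; rewrite e0 mul0mx => /rowP/(_ l); rewrite !mxE => <-.
by rewrite -[m](mulmxK uL) mL0 mul0mx.
Qed.

End construction.

Theorem proposition3p7 (R : realType) (d : nat) (hd : (1 <= d)%N)
    (alpha : 'rV[R]_d) (halpha : irrational_vector alpha)
    (gamma : R) (gamma_gt0 : 0 < gamma)
    (n0 : int) (n : 'I_d -> int)
    (hgamma : gamma = n0%:~R + \sum_(i < d) (n i)%:~R * alpha ord0 i) :
  (exists v : d.-tuple 'rV[R]_d,
     [/\ free v, (forall k, Zspan alpha (tnth v k)) &
         mes (parallelepiped v) = gamma%:E]) /\
  (gamma <= 1 ->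
   exists v : d.-tuple 'rV[R]_d,
     [/\ free v, (forall k, Zspan alpha (tnth v k)),
         mes (parallelepiped v) = gamma%:E &
         simple_set (parallelepiped v)]).
Proof.
case: d hd alpha halpha n hgamma => // k _ alpha _ n hgamma.
rewrite -[k.+1]/(1 + k)%N in alpha n hgamma *.
have [L uL [g nE]] := int_col_reduce (\col_i n i).
have gammaE : gamma = n0%:~R + (alpha *m map_mx intr L) 0 0 * g%:~R.
  rewrite hgamma; congr (_ + _).
  transitivity ((alpha *m map_mx intr (\col_i n i)) 0 0).
    by rewrite mxE; apply: eq_bigr => i _; rewrite !mxE mulrC.
  rewrite nE map_mxM mulmxA map_col_mx map_scalar_mx map_mx0.
  rewrite -{1}[alpha *m _]hsubmxK mul_row_col mulmx0 addr0 mul_mx_scalar.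
  rewrite [LHS]mxE [lsubmx _ _ _]mxE mulrC.
  by congr ((alpha *m _) 0 _ * _); apply: val_inj.
pose v := sheared_cube alpha gamma g L.
have vu : spanning_mx v \in unitmx by apply: spanning_sheared_cube_unit.
have vfree : free v by exact: spanning_mx_free.
have vspan i : Zspan alpha (tnth v i) by apply: sheared_cube_Zspan gammaE _.
have vmes : mes (parallelepiped v) = gamma%:E.
  by rewrite mes_parallelepiped// norm_det_sheared_cube.
split=> [|gamma1]; exists v; split => //.
by apply: simple_sheared_cube.
Qed.
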